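(* Consider a probe M5-brane whose static profile is described by functions $u(x_6)$, $\alpha(x_6)$ with effective $1+1$ dimensional action $S=\int dt\,dx_6\,L$, $$L=-H^{-1}\sqrt{1+H\frac{u^2}{\lambda_p^2}}\,\sqrt{1+H\left[(u\alpha')^2+(u')^2\right]}+H^{-1},$$ and energy $E=-\int dx_6\,L$ for static configurations. Let $E(\lambda)$ be the energy of the uniformly rescaled profile $u(\lambda x_6),\alpha(\lambda x_6)$. Extremizing $E(\lambda)$ at $\lambda=1$ gives the condition $$\left.\frac{dE(\lambda)}{d\lambda}\right|_{\lambda=1}=\int dx_6\;H^{-1}\left\{1-\frac{\sqrt{1+Hu^2/\lambda_p^2}}{\sqrt{1+H\left[(u\alpha')^2+(u')^2\right]}}\right\}=0 .$$ The integrand is the Noether charge density $P_6$ associated with the invariance under the shift $x_6\to x_6+a$, $a$ constant; equivalently, it is the ''energy'' of the $0+1$ dimensional system obtained by regarding $x_6$ as time. The supersymmetric profile, for which $P_6=0$, namely $$u=\sqrt{\frac{J\lambda_p}{2}}\sqrt{2\cosh\frac{2x_6}{\lambda_p}},\qquad \tan\alpha=\exp\left(2x_6/\lambda_p\right),$$ fulfills this Derrick-type condition.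
   Context: Primes denote $d/dx_6$, and $\lambda_p>0$ is a constant. The system is a fivebrane with $v=u(x_6)e^{i\varphi}\sin\alpha(x_6)$, $w=u(x_6)e^{-i\varphi}\cos\alpha(x_6)$, $\varphi=x_{11}/\lambda_p$, in the eleven-dimensional background of $N$ M5-branes $$ds^2=H^{-1/3}(dx_\mu^2+dx_6^2+dx_{11}^2)+H^{2/3}(|dv|^2+|dw|^2+dx_7^2),\qquad C_6=H^{-1}d^4x\wedge dx_6\wedge dx_{11},$$ with $H=1+\pi\lambda_Nl_s^2/|\vec r-\vec r_0|^3$, where $\vec r=(v,w,x_7)\in\mathbb{R}^5$, $\vec r_0$ is the position of the $N$ branes, $\lambda_N$ is the 't Hooft coupling and $l_s$ the string length. $L$ is invariant under shifts of $\alpha$ and of $x_6$, with associated Noether charges $$J=\frac{u^2\alpha'\sqrt{1+Hu^2/\lambda_p^2}}{\sqrt{1+H[(u\alpha')^2+(u')^2]}},\qquad P_6=L-u'\frac{\partial L}{\partial u'}-\alpha'\frac{\partial L}{\partial\alpha'}=H^{-1}-\frac{H^{-1}\sqrt{1+Hu^2/\lambda_p^2}}{\sqrt{1+H[(u\alpha')^2+(u')^2]}} ;$$ the constant $J$ in the supersymmetric profile is the value of the first charge. *)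

(* Defs.v *)
From HB Require Import structures.
From mathcomp Require Import all_boot all_order all_algebra.
From mathcomp Require Import all_classical all_reals all_analysis.

Set Implicit Arguments.
Unset Strict Implicit.
Unset Printing Implicit Defensive.

Import Order.TTheory GRing.Theory Num.Theory.
Import numFieldNormedType.Exports.

Local Open Scope classical_set_scope.
Local Open Scope ring_scope.

Definition cosh (R : realType) (x : R) : R := (expR x + expR (- x)) / 2.

(* R^5 with coordinates (Re v, Im v, Re w, Im w, x7) and its Euclidean norm;
   the norm that the library puts on row vectors is the sup norm. *)
Definition vec5 (R : realType) (r1 r2 r3 r4 r5 : R) : 'rV[R]_5 :=
  \row_(i < 5) [:: r1; r2; r3; r4; r5]`_i.

Definition enorm (R : realType) (n : nat) (r : 'rV[R]_n) : R :=
  Num.sqrt (\sum_(i < n) r ord0 i ^+ 2).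

(* The constants of the set-up: [r0] is the position of the N branes, [x7] the
   constant transverse coordinate of the probe, and [x11] the point of the
   eleventh direction at which the probe is looked at.  When v = w = 0 at [r0],
   nothing below depends on [x11], and the Lagrangian is invariant under shifts
   of alpha. *)
Record setup (R : realType) := Setup {
  lambda_p : R;
  lambda_N : R;
  l_s : R;
  r0 : 'rV[R]_5;
  x7 : R;
  x11 : R }.

Section Fivebrane.
Variables (R : realType) (S : setup R).

Definition warp (r : 'rV[R]_5) : R :=
  1 + pi * lambda_N S * l_s S ^+ 2 / enorm (r - r0 S) ^+ 3.

(* v = u e^{i phi} sin alpha, w = u e^{- i phi} cos alpha *)
Definition probe (u alpha : R) : 'rV[R]_5 :=
  let phi := x11 S / lambda_p S in
  vec5 (u * cos phi * sin alpha) (u * sin phi * sin alpha)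
       (u * cos phi * cos alpha) (- (u * sin phi * cos alpha)) (x7 S).

Definition H (u alpha : R) : R := warp (probe u alpha).

(* In functions of four real variables, [du] and [da] stand for u' and
   alpha'. *)
Definition lagrangian (u alpha du da : R) : R :=
  - (H u alpha)^-1 * Num.sqrt (1 + H u alpha * (u ^+ 2 / lambda_p S ^+ 2))
                   * Num.sqrt (1 + H u alpha * ((u * da) ^+ 2 + du ^+ 2))
  + (H u alpha)^-1.

Definition derrick_integrand (u alpha du da : R) : R :=
  (H u alpha)^-1 *
  (1 - Num.sqrt (1 + H u alpha * (u ^+ 2 / lambda_p S ^+ 2))
       / Num.sqrt (1 + H u alpha * ((u * da) ^+ 2 + du ^+ 2))).

(* This is - dL/dalpha', L being the function [lagrangian]. *)
Definition J_charge (u alpha du da : R) : R :=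
  u ^+ 2 * da * Num.sqrt (1 + H u alpha * (u ^+ 2 / lambda_p S ^+ 2))
  / Num.sqrt (1 + H u alpha * ((u * da) ^+ 2 + du ^+ 2)).

Definition susy_u (J : R) (x : R) : R :=
  Num.sqrt (J * lambda_p S / 2) * Num.sqrt (2 * cosh (2 * x / lambda_p S)).

End Fivebrane.

Section Mechanics.
Variables (R : realType) (L : R -> R -> R -> R -> R).

Definition d_u (u alpha du da : R) : R := derive1 (fun s => L s alpha du da) u.
Definition d_alpha (u alpha du da : R) : R := derive1 (fun s => L u s du da) alpha.
Definition d_du (u alpha du da : R) : R := derive1 (fun s => L u alpha s da) du.
Definition d_da (u alpha du da : R) : R := derive1 (fun s => L u alpha du s) da.

(* Noether charge of x -> x + a, with the sign convention L - q' dL/dq'; for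
   L = [lagrangian] this is P_6. *)
Definition shift_charge (u alpha du da : R) : R :=
  L u alpha du da - du * d_du u alpha du da - da * d_da u alpha du da.

(* The independent variable x plays the role of time. *)
Definition mechanical_energy (u alpha du da : R) : R :=
  du * d_du u alpha du da + da * d_da u alpha du da - L u alpha du da.

Definition along (F : R -> R -> R -> R -> R) (u alpha : R -> R) (x : R) : R :=
  F (u x) (alpha x) (derive1 u x) (derive1 alpha x).

Definition action (I : set R) (u alpha : R -> R) : R :=
  \int[lebesgue_measure]_(x in I) along L u alpha x.

Definition integrable_along (F : R -> R -> R -> R -> R)
    (I : set R) (u alpha : R -> R) : Prop :=
  lebesgue_measure.-integrable I (EFin \o along F u alpha).

Definition euler_lagrange (I : set R) (u alpha : R -> R) : Prop :=
  forall x, I x ->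
    is_derive x 1 (along d_du u alpha) (along d_u u alpha x) /\
    is_derive x 1 (along d_da u alpha) (along d_alpha u alpha x).

End Mechanics.

Section Profiles.
Variables (R : realType).

Definition C1 (I : set R) (f : R -> R) : Prop :=
  forall x, I x -> derivable f x 1 /\ {for x, continuous (derive1 f)}.

Definition twice_derivable (I : set R) (f : R -> R) : Prop :=
  forall x, I x -> derivable f x 1 /\ derivable (derive1 f) x 1.

Definition avoids_branes (S : setup R) (I : set R) (u alpha : R -> R) : Prop :=
  forall x, I x -> probe S (u x) (alpha x) != r0 S.

(* Energy of a static profile per unit volume of the directions other than
   x6. *)
Definition energy (S : setup R) (I : set R) (u alpha : R -> R) : R :=
  - action (lagrangian S) I u alpha.

(* A profile on I, rescaled, is a profile on I / lambda. *)
Definition rescale_dom (I : set R) (lambda : R) : set R :=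
  [set x | I (lambda * x)].

Definition rescale (f : R -> R) (lambda : R) : R -> R :=
  fun x => f (lambda * x).

Definition rescaled_energy (S : setup R) (I : set R) (u alpha : R -> R)
    (lambda : R) : R :=
  energy S (rescale_dom I lambda) (rescale u lambda) (rescale alpha lambda).

Definition shift_dom (I : set R) (c : R) : set R := [set x | I (x + c)].

Definition shift_profile (f : R -> R) (c : R) : R -> R := fun x => f (x + c).

End Profiles.

(* Main.v *)
Require Import Defs.
From HB Require Import structures.
From mathcomp Require Import all_boot all_order all_algebra.
From mathcomp Require Import all_classical all_reals all_analysis.
From mathcomp Require Import measurable_realfun ring lra.

Import Order.TTheory GRing.Theory Num.Theory.
Import numFieldNormedType.Exports.

Local Open Scope classical_set_scope.
Local Open Scope ring_scope.

Set Implicit Arguments.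
Unset Strict Implicit.
Unset Printing Implicit Defensive.

(** Derrick condition. Substituting y = lambda x turns the energy of the rescaled
    profile into the integral over the fixed set I of
      lambda^-1 H^-1 (A sqrt(1 + lambda^2 H q) - 1),
    where A = sqrt(1 + H u^2 / lambda_p^2) and q = (u alpha')^2 + u'^2.  Since A
    and B = sqrt(1 + H q) are at least 1, both this integrand and its derivative
    in lambda are dominated, for lambda near 1, by a multiple of
    |L| = H^-1 (A B - 1); one may therefore differentiate under the integral,
    and the derivative at lambda = 1 is H^-1 (1 - A / B) = P_6.

    Conservation of P_6 is the usual cancellation: by the chain rule and the
    Euler-Lagrange equations, (L - u' L_u' - alpha' L_alpha')' = 0.

    On the supersymmetric profile u' = u tanh t / lambda_p and
    alpha' = 1 / (lambda_p cosh t) with t = 2 x / lambda_p, so q = u^2 / lambda_p^2,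
    hence A = B and P_6 = 0. *)

(** * Affine changes of variable *)

Section AffineChange.
Variables (R : realType) (a c : R).
Hypothesis a_gt0 : 0 < a.

Local Notation mu := (@lebesgue_measure R).
Local Notation aff := ((fun x : R => a * x + c) : measurableTypeR R -> measurableTypeR R).

Lemma continuous_affine : continuous (fun x : R => a * x + c).
Proof.
by move=> x; apply: cvgD; [apply: cvgM; [exact: cvg_cst|exact: cvg_id]|exact: cvg_cst].
Qed.

Lemma measurable_affine : measurable_fun setT aff.
Proof. exact: continuous_measurable_fun continuous_affine. Qed.

Lemma measurable_preimage_affine (A : set R) :
  measurable A -> measurable (aff @^-1` A).
Proof. by move=> mA; rewrite -[X in measurable X]setTI; exact: measurable_affine. Qed.

(** Uniqueness of Lebesgue measure: [a] times the image of [mu] under [aff] gives every half-open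
    interval its length, hence equals [mu]. *)
Lemma lebesgue_measure_preimage_affine (A : set R) : measurable A ->
  mu (aff @^-1` A) = (a^-1%:E * mu A)%E.
Proof.
move=> mA; have a0 : 0 <= a by exact: ltW.
pose pushm : {measure set (measurableTypeR R) -> \bar R} :=
  measure_function_pushforward__canonical__measure_function_Measure mu
    measurable_affine.
have -> : mu A = mscale (NngNum a0) pushm A.
  apply: lebesgue_measure_unique mA => X [[x y] /= _ <-].
  rewrite /mscale /= /pushforward.
  have -> : aff @^-1` `]x, y] = `](x - c) / a, (y - c) / a]%classic.
    by apply/seteqP; split => t /=; rewrite !in_itv/= ltr_pdivrMr// ler_pdivlMr// ltrBlDr lerBrDr (mulrC t).
  rewrite !lebesgue_measure_itv/= !lte_fin ltr_pM2r ?invr_gt0// ltrD2r.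
  case: ifPn => _; last by rewrite mule0.
  by rewrite -!EFinD -EFinM; congr EFin; field; rewrite gt_eqF.
rewrite /mscale /= muleA -EFinM mulVf ?mul1e// gt_eqF//.
Qed.

Lemma ge0_integral_affine (D : set R) (f : R -> \bar R) :
  measurable D -> measurable_fun D f -> (forall x, D x -> (0 <= f x)%E) ->
  (\int[mu]_(x in aff @^-1` D) f (a * x + c)%R = a^-1%:E * \int[mu]_(x in D) f x)%E.
Proof.
move=> mD mf f0; have a0 : 0 <= a^-1 by rewrite invr_ge0 ltW.
rewrite -(ge0_integral_pushforward measurable_affine)//; last first.
  by move=> x; rewrite inE; exact: f0.
rewrite -(ge0_integral_mscale mu mD (NngNum a0))//.
apply: (eq_measure_integral (mscale (NngNum a0) mu)); first exact: measurable_affine.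
by move=> mphi A mA _; exact: lebesgue_measure_preimage_affine.
Qed.

Lemma measurable_fun_affine (D : set R) (f : R -> \bar R) :
  measurable D -> measurable_fun D f ->
  measurable_fun (aff @^-1` D) (fun x => f (a * x + c)).
Proof.
move=> mD mf; apply: (measurable_comp mD _ mf) => //.
  by move=> _ [x /= Dx <-].
exact: measurable_funS measurable_affine.
Qed.

Lemma integrable_affine (D : set R) (f : R -> \bar R) : measurable D ->
  mu.-integrable D f ->
  mu.-integrable (aff @^-1` D) (fun x => f (a * x + c)).
Proof.
move=> mD /integrableP[mf foo]; apply/integrableP; split.
  exact: measurable_fun_affine.
rewrite (@ge0_integral_affine D (fun x => `|f x|%E))//.
- by rewrite lte_mul_pinfty// ?lee_fin ?invr_ge0 ?ltW.
- exact: measurableT_comp.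
Qed.

(** Positive and negative parts are treated separately; integrability keeps their difference from
    being oo - oo when a^-1 is distributed over it. *)
Lemma Rintegral_affine (D : set R) (f : R -> R) : measurable D ->
  mu.-integrable D (EFin \o f) ->
  \int[mu]_(x in aff @^-1` D) f (a * x + c) = a^-1 * \int[mu]_(x in D) f x.
Proof.
move=> mD intf; have /integrableP[mf _] := intf.
rewrite /Rintegral -(fineM (x := a^-1%:E))//; last exact: integrable_fin_num.
congr fine; rewrite [LHS]integralE [X in (_ * X)%E]integralE.
rewrite muleBr//; last first.
  rewrite fin_num_adde_defl// fin_numN.
  exact/integrable_fin_num/integrable_funeneg.
rewrite -!ge0_integral_affine//; first by congr (_ - _)%E; apply: eq_integral => x _; rewrite ?funeposE ?funenegE.
- exact: measurable_funeneg mf.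
- exact: measurable_funepos mf.
Qed.

End AffineChange.

(** * Derivatives of the Lagrangian *)

Section PointwiseDerivatives.
Variable R : realType.
Implicit Types (f g : R -> R) (x df dg : R).

Lemma is_derive_add f g x df dg : is_derive x 1 f df -> is_derive x 1 g dg ->
  is_derive x 1 (fun y => f y + g y) (df + dg).
Proof. exact: is_deriveD. Qed.

Lemma is_derive_mul f g x df dg : is_derive x 1 f df -> is_derive x 1 g dg ->
  is_derive x 1 (fun y => f y * g y) (df * g x + f x * dg).
Proof.
move=> hf hg; apply: (@is_derive_eq _ _ _ (f * g)).
by rewrite /GRing.scale /= addrC (mulrC df).
Qed.

Lemma is_derive_opp f x df : is_derive x 1 f df ->
  is_derive x 1 (fun y => - f y) (- df).
Proof. exact: is_deriveN. Qed.

Lemma is_derive_sqr f x df : is_derive x 1 f df ->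
  is_derive x 1 (fun y => f y ^+ 2) (2 * f x * df).
Proof.
move=> hf; under eq_fun do rewrite expr2.
by apply: (is_derive_eq (is_derive_mul hf hf)); ring.
Qed.

Lemma is_derive_const (c x : R) : is_derive x 1 (fun _ : R => c) 0.
Proof. exact: is_derive_cst. Qed.

Lemma is_derive_inv f x df : f x != 0 -> is_derive x 1 f df ->
  is_derive x 1 (fun y => (f y)^-1) (- (f x) ^- 2 * df).
Proof. by move=> fx0 hf; exact: is_deriveV. Qed.

Lemma is_derive_sqrt f x df : 0 < f x -> is_derive x 1 f df ->
  is_derive x 1 (fun y => Num.sqrt (f y)) (df / (2 * Num.sqrt (f x))).
Proof.
move=> fx0 hf; rewrite mulrC.
exact: (is_derive1_comp (is_derive1_sqrt fx0) hf).
Qed.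

Lemma is_derive_derive1 f x df : is_derive x 1 f df -> derive1 f x = df.
Proof. by move=> hf; rewrite derive1E derive_val. Qed.

Lemma derivable_is_derive1 f x : derivable f x 1 -> is_derive x 1 f (derive1 f x).
Proof. by move=> hf; rewrite derive1E; exact: derivableP. Qed.

End PointwiseDerivatives.

Section FixedWarp.
Variables (R : realType) (l : R).

(* The value h of the warp factor is an independent variable here: at
   h = H u alpha, [lag] is convertible to [lagrangian] and [lag_charge] below to
   [derrick_integrand]. *)
Definition kin (h u : R) : R := Num.sqrt (1 + h * (u ^+ 2 / l ^+ 2)).
Definition vel (h u p q : R) : R := Num.sqrt (1 + h * ((u * q) ^+ 2 + p ^+ 2)).
Definition lag (h u p q : R) : R := - h^-1 * kin h u * vel h u p q + h^-1.

(** Closed forms of the four partial derivatives of [lag]; [lag_p] and [lag_q] are the momenta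
    conjugate to u and alpha. *)
Definition lag_h (h u p q : R) : R :=
  (h ^- 2) * (kin h u * vel h u p q - 1)
  - h^-1 * (u ^+ 2 / l ^+ 2 / (2 * kin h u) * vel h u p q
            + kin h u * (((u * q) ^+ 2 + p ^+ 2) / (2 * vel h u p q))).
Definition lag_u (h u p q : R) : R :=
  - (u / l ^+ 2 / kin h u * vel h u p q + kin h u * u * q ^+ 2 / vel h u p q).
Definition lag_p (h u p q : R) : R := - (kin h u * p / vel h u p q).
Definition lag_q (h u p q : R) : R := - (kin h u * u ^+ 2 * q / vel h u p q).

Lemma kin_arg_ge1 (h u : R) : 0 <= h -> 1 <= 1 + h * (u ^+ 2 / l ^+ 2).
Proof. by move=> h0; rewrite lerDl mulr_ge0// divr_ge0 ?sqr_ge0. Qed.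

Lemma vel_arg_ge1 (h u p q : R) : 0 <= h -> 1 <= 1 + h * ((u * q) ^+ 2 + p ^+ 2).
Proof. by move=> h0; rewrite lerDl mulr_ge0// addr_ge0 ?sqr_ge0. Qed.

Lemma sqrtr_ge1 (x : R) : 1 <= x -> 1 <= Num.sqrt x.
Proof. by move=> x1; rewrite -[leLHS](@sqrtr1 R) ler_wsqrtr. Qed.

Lemma kin_ge1 (h u : R) : 0 <= h -> 1 <= kin h u.
Proof. by move=> h0; apply/sqrtr_ge1/kin_arg_ge1. Qed.

Lemma vel_ge1 (h u p q : R) : 0 <= h -> 1 <= vel h u p q.
Proof. by move=> h0; apply/sqrtr_ge1/vel_arg_ge1. Qed.

Lemma sqr_vel (h u p q : R) : 0 <= h ->
  vel h u p q ^+ 2 = 1 + h * ((u * q) ^+ 2 + p ^+ 2).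
Proof. by move=> h0; rewrite sqr_sqrtr// (le_trans ler01)// vel_arg_ge1. Qed.

(** All four arguments move along curves at once: constant curves in three slots yield a partial
    derivative, general curves the total derivative along a profile. *)
Lemma is_derive_lag (h u p q : R -> R) (x dh du dp dq : R) : 0 < h x ->
  is_derive x 1 h dh -> is_derive x 1 u du ->
  is_derive x 1 p dp -> is_derive x 1 q dq ->
  is_derive x 1 (fun y => lag (h y) (u y) (p y) (q y))
    (dh * lag_h (h x) (u x) (p x) (q x) + du * lag_u (h x) (u x) (p x) (q x)
     + dp * lag_p (h x) (u x) (p x) (q x) + dq * lag_q (h x) (u x) (p x) (q x)).
Proof.
move=> hx0 hh hu hp hq.
have kin0 : 0 < kin (h x) (u x) by rewrite (lt_le_trans ltr01)// kin_ge1// ltW.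
have vel0 : 0 < vel (h x) (u x) (p x) (q x).
  by rewrite (lt_le_trans ltr01)// vel_ge1// ltW.
have dinv := is_derive_inv (lt0r_neq0 hx0) hh.
have dkin := is_derive_add (is_derive_const 1 x)
  (is_derive_mul hh (is_derive_mul (is_derive_sqr hu) (is_derive_const (l ^+ 2)^-1 x))).
have {}dkin := is_derive_sqrt (f := fun y => 1 + h y * (u y ^+ 2 / l ^+ 2))
  (lt_le_trans ltr01 (kin_arg_ge1 (u x) (ltW hx0))) dkin.
have dvel := is_derive_add (is_derive_const 1 x)
  (is_derive_mul hh (is_derive_add (is_derive_sqr (is_derive_mul hu hq)) (is_derive_sqr hp))).
have {}dvel := is_derive_sqrt (f := fun y => 1 + h y * ((u y * q y) ^+ 2 + p y ^+ 2))
  (lt_le_trans ltr01 (vel_arg_ge1 (u x) (p x) (q x) (ltW hx0))) dvel.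
apply: (is_derive_eq
  (is_derive_add (is_derive_mul (is_derive_mul (is_derive_opp dinv) dkin) dvel) dinv)).
rewrite -/(kin _ _) -/(vel _ _ _ _) /lag_h /lag_u /lag_p /lag_q.
move: (kin _ _) (vel _ _ _ _) kin0 vel0 => A B A0 B0.
rewrite -!exprVn; move: (l^-1) => m; field.
by rewrite !gt_eqF.
Qed.

End FixedWarp.

(** * The charge at a fixed warp factor, and bounds under scaling of the velocities *)

Section FixedWarpScaling.
Variables (R : realType) (l : R).

Definition lag_charge (h u p q : R) : R := h^-1 * (1 - kin l h u / vel h u p q).

(** Put A = [kin] and B = [vel]. Since (u q)^2 + p^2 = (B^2 - 1) / h, the momentum terms add up to A
    (B^2 - 1) / (h B), which turns - A B / h into - A / (h B). *)
Lemma lag_chargeE (h u p q : R) : 0 < h ->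
  lag_charge h u p q = lag l h u p q - p * lag_p l h u p q - q * lag_q l h u p q.
Proof.
move=> h0; rewrite /lag_charge /lag /lag_p /lag_q.
have B0 : 0 < vel h u p q by rewrite (lt_le_trans ltr01)// vel_ge1// ltW.
have := sqr_vel u p q (ltW h0); move: (vel h u p q) B0 => B B0 B2.
have p2 : p ^+ 2 = (B ^+ 2 - 1) / h - (u * q) ^+ 2.
  by rewrite B2; field; rewrite gt_eqF.
move: (kin _ _ _) => A.
rewrite (_ : p * - (A * p / B) = - A * p ^+ 2 / B); last by field; rewrite gt_eqF.
by rewrite p2; field; rewrite !gt_eqF.
Qed.

(** With b = sqrt (1 + t), the square of 1 + (1 + k) (b - 1) exceeds 1 + k t by 2 (b - 1) + (1 + k +
    k^2) (b - 1)^2, which is nonnegative. *)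
Lemma sqrt_scale_le (k t : R) : 0 <= k -> 0 <= t ->
  Num.sqrt (1 + k * t) - 1 <= (1 + k) * (Num.sqrt (1 + t) - 1).
Proof.
move=> k0 t0; have b1 : 1 <= Num.sqrt (1 + t) by rewrite sqrtr_ge1// lerDl.
have tE : t = Num.sqrt (1 + t) ^+ 2 - 1 by rewrite sqr_sqrtr ?addr_ge0//; ring.
set b := Num.sqrt (1 + t) in b1 tE *; rewrite lerBlDl.
have pos : 0 <= 1 + (1 + k) * (b - 1).
  by rewrite addr_ge0// mulr_ge0 ?subr_ge0// addr_ge0.
rewrite -[leRHS](ger0_norm pos) -sqrtr_sqr ler_wsqrtr// tE.
have -> : (1 + (1 + k) * (b - 1)) ^+ 2 =
    1 + k * (b ^+ 2 - 1) + 2 * (b - 1) + (1 + k + k ^+ 2) * (b - 1) ^+ 2 by ring.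
rewrite -addrA lerDl addr_ge0// mulr_ge0 ?sqr_ge0 ?subr_ge0//.
by rewrite !addr_ge0 ?sqr_ge0.
Qed.

Lemma vel_scale_le (k h u p q : R) : 0 <= h ->
  vel h u (k * p) (k * q) - 1 <= (1 + k ^+ 2) * (vel h u p q - 1).
Proof.
move=> h0; rewrite /vel (_ : 1 + _ = 1 + k ^+ 2 * (h * ((u * q) ^+ 2 + p ^+ 2))); last by ring.
by apply: sqrt_scale_le; rewrite ?sqr_ge0// mulr_ge0// addr_ge0 ?sqr_ge0.
Qed.

Lemma norm_lag (h u p q : R) : 0 < h ->
  `|lag l h u p q| = h^-1 * (kin l h u * vel h u p q - 1).
Proof.
move=> h0; rewrite /lag (_ : _ + _ = - (h^-1 * (kin l h u * vel h u p q - 1))); last by ring.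
rewrite normrN ger0_norm// mulr_ge0 ?invr_ge0 ?(ltW h0)// subr_ge0.
by rewrite mulr_ege1 ?kin_ge1 ?vel_ge1 ?(ltW h0).
Qed.

(** Write A B - 1 = A (B - 1) + (A - 1). Scaling the velocities leaves A alone; [vel_scale_le]
    controls the first term, and the second, being nonnegative, only grows when multiplied by 1 +
    k^2. *)
Lemma norm_lag_scale (k h u p q : R) : 0 < h ->
  `|lag l h u (k * p) (k * q)| <= (1 + k ^+ 2) * `|lag l h u p q|.
Proof.
move=> h0; rewrite !norm_lag// mulrCA ler_pM2l ?invr_gt0//.
have A1 := kin_ge1 l u (ltW h0); have := vel_scale_le k u p q (ltW h0).
move: (kin _ _ _) A1 (vel _ _ _ _) (vel _ _ _ _) => A A1 Bk B le.
have k0 := sqr_ge0 k; have A0 : 0 <= A by lra.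
have := ler_wpM2l A0 le; have : 0 <= k ^+ 2 * (A - 1) by rewrite mulr_ge0// subr_ge0.
by lra.
Qed.

(** For A, B >= 1 one has |1 - A / B| <= A B - 1, so the charge is bounded by the Lagrangian at the
    same scaled velocities. After multiplication by B the two inequalities become A (B^2 - 1) >= 0
    and A (B^2 + 1) >= 2 B. *)
Lemma norm_lag_charge_scale (k h u p q : R) : 0 < h ->
  `|lag_charge h u (k * p) (k * q)| <= (1 + k ^+ 2) * `|lag l h u p q|.
Proof.
move=> h0; apply: le_trans (norm_lag_scale k u p q h0).
rewrite norm_lag// /lag_charge normrM ger0_norm ?invr_ge0 ?(ltW h0)//.
rewrite ler_pM2l ?invr_gt0//.
have A1 := kin_ge1 l u (ltW h0); have B1 := vel_ge1 u (k * p) (k * q) (ltW h0).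
move: (kin _ _ _) (vel _ _ _ _) A1 B1 => A B A1 B1.
have B0 : 0 < B by lra.
have -> : 1 - A / B = (B - A) / B by field; rewrite gt_eqF.
rewrite normrM normfV (ger0_norm (ltW B0)) ler_pdivrMr// ler_norml.
have : 0 <= (A - 1) * (B - 1) by rewrite mulr_ge0// subr_ge0.
have : 0 <= (A - 1) * (B - 1) * B by rewrite !mulr_ge0 ?subr_ge0// ltW.
have : 0 <= (B - 1) ^+ 2 by exact: sqr_ge0.
have : 0 <= A * (B - 1) ^+ 2 by rewrite mulr_ge0 ?sqr_ge0//; lra.
by move=> *; apply/andP; split; nra.
Qed.

Lemma continuous_lag (h u p q : R -> R) (x : R) : 0 < h x ->
  {for x, continuous h} -> {for x, continuous u} ->
  {for x, continuous p} -> {for x, continuous q} ->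
  {for x, continuous (fun y => lag l (h y) (u y) (p y) (q y))} /\
  {for x, continuous (fun y => lag_charge (h y) (u y) (p y) (q y))}.
Proof.
move=> h0 ch cu cp cq.
have csqr (f : R -> R) : {for x, continuous f} -> {for x, continuous (fun y => f y ^+ 2)}.
  move=> cf; rewrite (_ : (fun y => f y ^+ 2) = (fun y => f y * f y)).
    exact: continuousM.
  by apply/funext => y; rewrite expr2.
have csqrt (f : R -> R) : {for x, continuous f} ->
    {for x, continuous (fun y => Num.sqrt (f y))}.
  by move=> cf; apply: (continuous_comp cf); exact: sqrt_continuous.
have ccst (c : R) : {for x, continuous (fun _ : R => c)} by exact: cvg_cst.
have cV : {for x, continuous (fun y => (h y)^-1)}.
  by apply: cvgV ch; rewrite gt_eqF.
have cA : {for x, continuous (fun y => kin l (h y) (u y))}.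
  apply: csqrt; apply: continuousD; first exact: ccst.
  apply: continuousM => //; apply: continuousM; [exact: csqr|exact: ccst].
have cB : {for x, continuous (fun y => vel (h y) (u y) (p y) (q y))}.
  apply: csqrt; apply: continuousD; first exact: ccst.
  apply: continuousM => //; apply: continuousD; last exact: csqr.
  by apply: csqr; exact: continuousM.
split.
  apply: continuousD => //; apply: continuousM => //; apply: continuousM => //.
  exact: continuousN.
apply: continuousM => //; apply: continuousB; first exact: ccst.
apply: continuousM => //; apply: continuousV => //.
by rewrite gt_eqF// (lt_le_trans ltr01)// vel_ge1// ltW.
Qed.

End FixedWarpScaling.

(** * Differentiability of the warp factor at the position of the probe *)

Section Warp.
Variables (R : realType) (S : setup R).

(** The squared distance to the branes in coordinates, so that it can be differentiated term by
    term. The fourth term has a plus sign because Im w = - u sin phi cos alpha, and the overall sign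
    is lost in the square. *)
Definition sqdist (u alpha : R) : R :=
  let phi := x11 S / lambda_p S in
  (u * cos phi * sin alpha - r0 S ord0 (inord 0)) ^+ 2
  + (u * sin phi * sin alpha - r0 S ord0 (inord 1)) ^+ 2
  + (u * cos phi * cos alpha - r0 S ord0 (inord 2)) ^+ 2
  + (u * sin phi * cos alpha + r0 S ord0 (inord 3)) ^+ 2
  + (x7 S - r0 S ord0 (inord 4)) ^+ 2.

Lemma sum_sqr_probe (u alpha : R) :
  \sum_(i < 5) (probe S u alpha - r0 S) ord0 i ^+ 2 = sqdist u alpha.
Proof.
rewrite !big_ord_recl big_ord0 /probe /vec5 !mxE /= /sqdist addr0 !addrA.
(* Unrolling the sum yields indices that are iterated [lift]s of [ord0]; they are matched with the
   [inord k] of [sqdist] by their values. *)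
have e k (i : 'I_5) : nat_of_ord i = k -> inord k = i.
  by move=> <-; rewrite inord_val.
rewrite !(e 0%N ord0)//.
rewrite (e 1%N (lift ord0 ord0))// (e 2%N (lift ord0 (lift ord0 ord0)))//.
rewrite (e 3%N (lift ord0 (lift ord0 (lift ord0 ord0))))//.
rewrite (e 4%N (lift ord0 (lift ord0 (lift ord0 (lift ord0 ord0)))))//.
by congr (_ + _ + _); rewrite -opprD sqrrN.
Qed.

Lemma H_sqdist (u alpha : R) : H S u alpha =
  1 + pi * lambda_N S * l_s S ^+ 2 / Num.sqrt (sqdist u alpha) ^+ 3.
Proof. by rewrite /H /warp /enorm sum_sqr_probe. Qed.

Lemma sqdist_gt0 (u alpha : R) : probe S u alpha != r0 S -> 0 < sqdist u alpha.
Proof.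
move=> nbrane; rewrite -sum_sqr_probe lt_def sumr_ge0 ?andbT; last first.
  by move=> i _; exact: sqr_ge0.
apply: contra nbrane; rewrite psumr_eq0; last by move=> i _; exact: sqr_ge0.
move=> /allP z; apply/eqP/rowP => i; apply/eqP; rewrite -subr_eq0.
have := z i (mem_index_enum i); rewrite sqrf_eq0 !mxE/=.
by [].
Qed.

(* Differentiability of a function of two variables, in the form of a chain rule
   along arbitrary curves through the point. *)
Lemma H_differentiable (u0 alpha0 : R) : probe S u0 alpha0 != r0 S ->
  exists Hu Ha : R, forall (u alpha : R -> R) (x du da : R),
    u x = u0 -> alpha x = alpha0 ->
    is_derive x 1 u du -> is_derive x 1 alpha da ->
    is_derive x 1 (fun y => H S (u y) (alpha y)) (du * Hu + da * Ha).
Proof.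
move=> /sqdist_gt0 d0; set d := sqdist u0 alpha0 in d0.
have s0 : 0 < Num.sqrt d by rewrite sqrtr_gt0.
pose phi := x11 S / lambda_p S.
pose a1 := u0 * cos phi * sin alpha0 - r0 S ord0 (inord 0).
pose a2 := u0 * sin phi * sin alpha0 - r0 S ord0 (inord 1).
pose a3 := u0 * cos phi * cos alpha0 - r0 S ord0 (inord 2).
pose a4 := u0 * sin phi * cos alpha0 + r0 S ord0 (inord 3).
(* [K] is the derivative at t = d of c t^(-3/2), where c = pi lambda_N l_s^2; the two witnesses are
   [K] times the partial derivatives of [sqdist] in u and alpha. *)
pose K : R := - (3 / 2) * (pi * lambda_N S * l_s S ^+ 2) / Num.sqrt d ^+ 5.
exists (K * (2 * (a1 * cos phi * sin alpha0 + a2 * sin phi * sin alpha0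
                  + a3 * cos phi * cos alpha0 + a4 * sin phi * cos alpha0))).
exists (K * (2 * u0 * (a1 * cos phi * cos alpha0 + a2 * sin phi * cos alpha0
                  - a3 * cos phi * sin alpha0 - a4 * sin phi * sin alpha0))).
move=> u alpha x du da ux ax hu ha.
have hs := is_derive1_comp (is_derive_sin (alpha x)) ha.
have hc := is_derive1_comp (is_derive_cos (alpha x)) ha.
have cst (c : R) := is_derive_const c x.
have dsq : is_derive x 1 (fun y => sqdist (u y) (alpha y)) _ :=
  is_derive_add (is_derive_add (is_derive_add (is_derive_add
    (is_derive_sqr (is_derive_add (is_derive_mul (is_derive_mul hu (cst (cos phi))) hs)
       (cst (- r0 S ord0 (inord 0)))))
    (is_derive_sqr (is_derive_add (is_derive_mul (is_derive_mul hu (cst (sin phi))) hs)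
       (cst (- r0 S ord0 (inord 1))))))
    (is_derive_sqr (is_derive_add (is_derive_mul (is_derive_mul hu (cst (cos phi))) hc)
       (cst (- r0 S ord0 (inord 2))))))
    (is_derive_sqr (is_derive_add (is_derive_mul (is_derive_mul hu (cst (sin phi))) hc)
       (cst (r0 S ord0 (inord 3))))))
    (cst ((x7 S - r0 S ord0 (inord 4)) ^+ 2)).
have dE : sqdist (u x) (alpha x) = d by rewrite ux ax.
have d0x : 0 < sqdist (u x) (alpha x) by rewrite dE.
have dsqrt := is_derive_sqrt (f := fun y => sqdist (u y) (alpha y)) d0x dsq.
have dcube := is_derive_mul dsqrt (is_derive_sqr dsqrt).
have cube0 : Num.sqrt (sqdist (u x) (alpha x)) * Num.sqrt (sqdist (u x) (alpha x)) ^+ 2 != 0.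
  by rewrite dE mulf_neq0 ?expf_neq0// gt_eqF.
have := is_derive_add (cst 1)
  (is_derive_mul (cst (pi * lambda_N S * l_s S ^+ 2)) (is_derive_inv (f := fun y => Num.sqrt (sqdist (u y) (alpha y)) *
    Num.sqrt (sqdist (u y) (alpha y)) ^+ 2) cube0 dcube)).
have -> : (fun y => 1 + pi * lambda_N S * l_s S ^+ 2 /
    (Num.sqrt (sqdist (u y) (alpha y)) * Num.sqrt (sqdist (u y) (alpha y)) ^+ 2)) =
    (fun y => H S (u y) (alpha y)).
  by apply/funext => y; rewrite H_sqdist -exprS.
move=> dH; apply: (is_derive_eq dH).
rewrite /= dE ux ax -/phi -/a1 -/a2 -/a3 -/a4 /K.
move: (Num.sqrt d) s0 => s s0; field.
by rewrite gt_eqF.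
Qed.

End Warp.

(** * The charge P_6 *)

Section Charges.
Variables (R : realType) (S : setup R).
Hypotheses (lambda_N_gt0 : 0 < lambda_N S).

(** This includes the branes themselves: the distance vanishes there, the inverse of 0 is 0, and [H]
    is 1. The pointwise identities for the charges therefore hold for all u and alpha. *)
Lemma H_ge1 (u alpha : R) : 1 <= H S u alpha.
Proof.
rewrite /H /warp lerDl divr_ge0 ?exprn_ge0 ?sqrtr_ge0//.
by rewrite mulr_ge0 ?sqr_ge0// mulr_ge0 ?pi_ge0// ltW.
Qed.

Lemma H_gt0 (u alpha : R) : 0 < H S u alpha.
Proof. exact: lt_le_trans ltr01 (H_ge1 u alpha). Qed.

Lemma d_du_lagrangian (u alpha p q : R) :
  d_du (lagrangian S) u alpha p q = lag_p (lambda_p S) (H S u alpha) u p q.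
Proof.
have dL := is_derive_lag (lambda_p S) (x := p) (h := fun=> H S u alpha) (H_gt0 u alpha)
  (is_derive_const _ _) (is_derive_const u _) (is_derive_id _ _) (is_derive_const q _).
by rewrite /d_du (is_derive_derive1 dL) !mul0r mul1r addr0 !add0r.
Qed.

Lemma d_da_lagrangian (u alpha p q : R) :
  d_da (lagrangian S) u alpha p q = lag_q (lambda_p S) (H S u alpha) u p q.
Proof.
have dL := is_derive_lag (lambda_p S) (x := q) (h := fun=> H S u alpha) (H_gt0 u alpha)
  (is_derive_const _ _) (is_derive_const u _) (is_derive_const p _) (is_derive_id _ _).
by rewrite /d_da (is_derive_derive1 dL) !mul0r mul1r !add0r.
Qed.

Lemma derrick_integrand_shift_charge (u alpha p q : R) :
  derrick_integrand S u alpha p q = shift_charge (lagrangian S) u alpha p q.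
Proof.
rewrite /shift_charge d_du_lagrangian d_da_lagrangian.
exact: lag_chargeE (H_gt0 u alpha).
Qed.

Lemma derive1_opp (f : R -> R) (x : R) : derivable f x 1 ->
  derive1 (fun y => - f y) x = - derive1 f x.
Proof. by move=> /derivable_is_derive1 /is_derive_opp /is_derive_derive1. Qed.

(** The energy is minus the action, so the 0+1 system has Lagrangian -L, and q' d(-L)/dq' - (-L) = L
    - q' dL/dq'. *)
Lemma mechanical_energy_opp (u alpha p q : R) :
  mechanical_energy (fun u alpha du da => - lagrangian S u alpha du da) u alpha p q
  = shift_charge (lagrangian S) u alpha p q.
Proof.
rewrite /mechanical_energy /shift_charge /d_du /d_da !derive1_opp; first by ring.
- have [] // := is_derive_lag (lambda_p S) (x := q) (h := fun=> H S u alpha) (H_gt0 u alpha)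
  (is_derive_const _ _) (is_derive_const u _) (is_derive_const p _) (is_derive_id _ _).
- have [] // := is_derive_lag (lambda_p S) (x := p) (h := fun=> H S u alpha) (H_gt0 u alpha)
  (is_derive_const _ _) (is_derive_const u _) (is_derive_id _ _) (is_derive_const q _).
Qed.

Lemma lagrangian_chain_rule (u alpha p q : R -> R) (x du da dp dq : R) :
  probe S (u x) (alpha x) != r0 S ->
  is_derive x 1 u du -> is_derive x 1 alpha da ->
  is_derive x 1 p dp -> is_derive x 1 q dq ->
  is_derive x 1 (fun y => lagrangian S (u y) (alpha y) (p y) (q y))
    (du * d_u (lagrangian S) (u x) (alpha x) (p x) (q x)
     + da * d_alpha (lagrangian S) (u x) (alpha x) (p x) (q x)
     + dp * d_du (lagrangian S) (u x) (alpha x) (p x) (q x)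
     + dq * d_da (lagrangian S) (u x) (alpha x) (p x) (q x)).
Proof.
move=> /H_differentiable[Hu [Ha dH]].
pose l := lambda_p S; pose h := H S (u x) (alpha x).
(* Arbitrary curves through the point are allowed: coordinate lines then give [d_u] and [d_alpha],
   with their contributions through [H], and the given curves give the claim. *)
have chain (f g r s : R -> R) (t df dg dr ds : R) :
    f t = u x -> g t = alpha x -> r t = p x -> s t = q x ->
    is_derive t 1 f df -> is_derive t 1 g dg ->
    is_derive t 1 r dr -> is_derive t 1 s ds ->
    is_derive t 1 (fun y => lagrangian S (f y) (g y) (r y) (s y))
      (df * (Hu * lag_h l h (u x) (p x) (q x) + lag_u l h (u x) (p x) (q x))
       + dg * (Ha * lag_h l h (u x) (p x) (q x))
       + dr * lag_p l h (u x) (p x) (q x) + ds * lag_q l h (u x) (p x) (q x)).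
  move=> ft gt rt st hf hg hr hs.
  have := is_derive_lag l (h := fun y => H S (f y) (g y)) (H_gt0 (f t) (g t))
    (dH _ _ _ _ _ ft gt hf hg) hf hr hs.
  by move=> dL; apply: (is_derive_eq dL); rewrite ft gt rt st; ring.
have -> : d_u (lagrangian S) (u x) (alpha x) (p x) (q x) =
    Hu * lag_h l h (u x) (p x) (q x) + lag_u l h (u x) (p x) (q x).
  rewrite /d_u (is_derive_derive1 (chain _ _ _ _ _ _ _ _ _ erefl erefl erefl erefl
    (is_derive_id _ _) (is_derive_const _ _) (is_derive_const _ _) (is_derive_const _ _))).
  by rewrite !mul0r mul1r !addr0.
have -> : d_alpha (lagrangian S) (u x) (alpha x) (p x) (q x) =
    Ha * lag_h l h (u x) (p x) (q x).
  rewrite /d_alpha (is_derive_derive1 (chain _ _ _ _ _ _ _ _ _ erefl erefl erefl erefl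
    (is_derive_const _ _) (is_derive_id _ _) (is_derive_const _ _) (is_derive_const _ _))).
  by rewrite !mul0r mul1r !addr0 add0r.
by rewrite d_du_lagrangian d_da_lagrangian => hu ha hp hq; exact: chain.
Qed.

Lemma is_derive_shift_charge (I : set R) (u alpha : R -> R) (x : R) : I x ->
  twice_derivable I u -> twice_derivable I alpha -> avoids_branes S I u alpha ->
  euler_lagrange (lagrangian S) I u alpha ->
  is_derive x 1 (along (shift_charge (lagrangian S)) u alpha) 0.
Proof.
move=> Ix du da nb el; have [/derivable_is_derive1 hu /derivable_is_derive1 hp] := du x Ix.
have [/derivable_is_derive1 ha /derivable_is_derive1 hq] := da x Ix.
have [elu ela] := el x Ix.
have dL := lagrangian_chain_rule (nb x Ix) hu ha hp hq.
have dP := is_derive_add (is_derive_add dL (is_derive_opp (is_derive_mul hp elu)))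
  (is_derive_opp (is_derive_mul hq ela)).
(* Here p, q are the velocities, dp, dq the accelerations, a, b the values of [d_u], [d_alpha], and
   c, d those of [d_du], [d_da]. *)
have cancel (p q dp dq a b c d : R) :
    p * a + q * b + dp * c + dq * d - (dp * c + p * a) - (dq * d + q * b) = 0.
  by ring.
by apply: (is_derive_eq dP); exact: cancel.
Qed.

End Charges.

Lemma is_derive0_cst_interval (R : realType) (I : set R) (f : R -> R) :
  is_interval I -> (forall x, I x -> is_derive x 1 f 0) ->
  forall x y, I x -> I y -> f x = f y.
Proof.
move=> itvI df; suff cst x y : x <= y -> I x -> I y -> f x = f y.
  by move=> x y Ix Iy; have [/cst|/ltW/cst <-] := leP x y; rewrite //; exact.
move=> xy Ix Iy; have sub z : z \in `[x, y] -> I z.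
  by rewrite in_itv/=; exact: itvI.
have [||z _ /eqP] := @MVT_segment _ f (cst 0) x y xy.
- by move=> z /subset_itv_oo_cc /sub; exact: df.
- by apply: derivable_within_continuous => z /sub/df[].
- by rewrite mul0r subr_eq0 => /eqP.
Qed.

(** * Rescaled and shifted profiles *)

Section Rescaling.
Variables (R : realType) (S : setup R).
Hypotheses (lambda_N_gt0 : 0 < lambda_N S).
Variables (I : set R) (u alpha : R -> R).
Hypotheses (openI : open I) (C1u : C1 I u) (C1alpha : C1 I alpha)
  (nbranes : avoids_branes S I u alpha).

Local Notation mu := (@lebesgue_measure R).

Let mI : measurable I. Proof. exact: open_measurable. Qed.

(** What the integrand of a rescaled profile becomes after the substitution: the position is that of
    the original profile, and only the velocities carry the factor k. *)
Definition scaled_along (F : R -> R -> R -> R -> R) (k x : R) : R :=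
  F (u x) (alpha x) (k * derive1 u x) (k * derive1 alpha x).

Lemma scaled_along1 (F : R -> R -> R -> R -> R) : scaled_along F 1 = along F u alpha.
Proof. by apply/funext => x; rewrite /scaled_along !mul1r. Qed.

Lemma derivable_continuous (f : R -> R) (x : R) : derivable f x 1 -> {for x, continuous f}.
Proof. by move=> df; apply: differentiable_continuous; exact/derivable1_diffP. Qed.

Lemma derive1_affine_comp (f : R -> R) (a c x : R) : derivable f (a * x + c) 1 ->
  derive1 (fun y => f (a * y + c)) x = a * derive1 f (a * x + c).
Proof.
move=> /derivable_is_derive1 df.
have da := is_derive_add (is_derive_mul (is_derive_const a x) (is_derive_id x 1))
  (is_derive_const c x).
have dfa := is_derive1_comp (g := fun y => a * y + c) df da.
by rewrite (is_derive_derive1 dfa); ring.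
Qed.

Lemma along_affine (F : R -> R -> R -> R -> R) (a c x : R) : I (a * x + c) ->
  along F (fun y => u (a * y + c)) (fun y => alpha (a * y + c)) x
  = scaled_along F a (a * x + c).
Proof.
by move=> Ix; rewrite /along !derive1_affine_comp//;
  [have [] := C1alpha Ix|have [] := C1u Ix].
Qed.

Lemma continuous_scaled (k x : R) : I x ->
  {for x, continuous (scaled_along (lagrangian S) k)} /\
  {for x, continuous (scaled_along (derrick_integrand S) k)}.
Proof.
move=> Ix; have [du cu] := C1u Ix; have [da ca] := C1alpha Ix.
have [Hu [Ha dH]] := H_differentiable (nbranes Ix).
have [dHx _] := dH u alpha x _ _ erefl erefl
  (derivable_is_derive1 du) (derivable_is_derive1 da).
have cscale (f : R -> R) : {for x, continuous f} -> {for x, continuous (fun y => k * f y)}.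
  by move=> cf; apply: continuousM => //; exact: cvg_cst.
exact: (continuous_lag (lambda_p S) (h := fun y => H S (u y) (alpha y))
  (H_gt0 lambda_N_gt0 (u x) (alpha x)) (derivable_continuous dHx)
  (derivable_continuous du) (cscale _ cu) (cscale _ ca)).
Qed.

Lemma measurable_scaled_lagrangian (k : R) :
  measurable_fun I (scaled_along (lagrangian S) k).
Proof.
apply: open_continuous_measurable_fun => // x /set_mem Ix.
by have [] := continuous_scaled k Ix.
Qed.

Lemma measurable_scaled_derrick (k : R) :
  measurable_fun I (scaled_along (derrick_integrand S) k).
Proof.
apply: open_continuous_measurable_fun => // x /set_mem Ix.
by have [] := continuous_scaled k Ix.
Qed.

Lemma norm_scaled_lagrangian (k x : R) :
  `|scaled_along (lagrangian S) k x| <= (1 + k ^+ 2) * `|along (lagrangian S) u alpha x|.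
Proof. exact: norm_lag_scale (H_gt0 _ _ _). Qed.

Lemma norm_scaled_derrick (k x : R) :
  `|scaled_along (derrick_integrand S) k x|
  <= (1 + k ^+ 2) * `|along (lagrangian S) u alpha x|.
Proof. exact: norm_lag_charge_scale (H_gt0 _ _ _). Qed.

Hypothesis int_lagrangian : integrable_along (lagrangian S) I u alpha.

Let int_majorant (k : R) :
  mu.-integrable I (EFin \o (fun x => k * `|along (lagrangian S) u alpha x|)).
Proof.
apply: (@eq_integrable _ _ _ mu I mI (fun x => (k%:E * `|(along (lagrangian S) u alpha x)%:E|)%E)).
  by [].
by apply: integrableZl => //; exact: integrable_abse.
Qed.

Lemma integrable_scaled_lagrangian (k : R) :
  mu.-integrable I (EFin \o scaled_along (lagrangian S) k).
Proof.
apply: (@le_integrable _ _ _ mu I mI _ _ _ _ (int_majorant (1 + k ^+ 2))).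
  by apply/measurable_EFinP; exact: measurable_scaled_lagrangian.
move=> x _ /=; rewrite lee_fin (le_trans (norm_scaled_lagrangian k x))//.
exact: ler_norm.
Qed.

Lemma integrable_derrick : integrable_along (derrick_integrand S) I u alpha.
Proof.
rewrite /integrable_along -scaled_along1.
apply: (@le_integrable _ _ _ mu I mI _ _ _ _ (int_majorant (1 + 1 ^+ 2))).
  by apply/measurable_EFinP; exact: measurable_scaled_derrick.
move=> x _ /=; rewrite lee_fin (le_trans (norm_scaled_derrick 1 x))//.
exact: ler_norm.
Qed.

Section AffineProfile.
Variables (a c : R) (a_gt0 : 0 < a).
Let J : set R := (fun x => a * x + c) @^-1` I.
Let mJ : measurable J. Proof. exact: measurable_preimage_affine. Qed.

Lemma integrable_along_affine :
  integrable_along (lagrangian S) J (fun x => u (a * x + c)) (fun x => alpha (a * x + c)).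
Proof.
apply: (@eq_integrable _ _ _ mu J mJ _ _ _
  (integrable_affine c a_gt0 mI (integrable_scaled_lagrangian a))) => //.
by move=> x /set_mem Jx; rewrite /= along_affine.
Qed.

(** Shifts are the case a = 1 and rescalings the case c = 0, so one change of variables serves
    both. *)
Lemma action_affine :
  action (lagrangian S) J (fun x => u (a * x + c)) (fun x => alpha (a * x + c))
  = a^-1 * \int[mu]_(x in I) scaled_along (lagrangian S) a x.
Proof.
rewrite -(Rintegral_affine c)//; last exact: integrable_scaled_lagrangian.
by apply: eq_Rintegral => x /set_mem Jx; rewrite along_affine.
Qed.

End AffineProfile.

Lemma shift_affine (c : R) :
  [/\ shift_dom I c = (fun x => 1 * x + c) @^-1` I,
      shift_profile u c = (fun x => u (1 * x + c)) &
      shift_profile alpha c = (fun x => alpha (1 * x + c))].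
Proof. by split; [apply/seteqP; split => x /=|apply/funext => x..]; rewrite /shift_dom/= mul1r. Qed.

Lemma rescale_affine (k : R) :
  [/\ rescale_dom I k = (fun x => k * x + 0) @^-1` I,
      rescale u k = (fun x => u (k * x + 0)) &
      rescale alpha k = (fun x => alpha (k * x + 0))].
Proof. by split; [apply/seteqP; split => x /=|apply/funext => x..]; rewrite /rescale_dom/= addr0. Qed.

Lemma shift_invariance (c : R) :
  integrable_along (lagrangian S) (shift_dom I c) (shift_profile u c) (shift_profile alpha c)
  /\ action (lagrangian S) (shift_dom I c) (shift_profile u c) (shift_profile alpha c)
     = action (lagrangian S) I u alpha.
Proof.
have [-> -> ->] := shift_affine c; split; first exact: integrable_along_affine.
by rewrite action_affine// invr1 mul1r scaled_along1.
Qed.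

Lemma integrable_rescale (k : R) : 0 < k ->
  integrable_along (lagrangian S) (rescale_dom I k) (rescale u k) (rescale alpha k).
Proof. by have [-> -> ->] := rescale_affine k; exact: integrable_along_affine. Qed.

(** All dependence on k now sits in the integrand, which prepares differentiation under the integral
    sign. *)
Lemma rescaled_energyE (k : R) : 0 < k -> rescaled_energy S I u alpha k
  = \int[mu]_(x in I) (- k^-1 * scaled_along (lagrangian S) k x).
Proof.
move=> k0; rewrite /rescaled_energy /energy; have [-> -> ->] := rescale_affine k.
rewrite action_affine// RintegralZl// ?mulNr//.
exact: integrable_scaled_lagrangian.
Qed.

(** The derivative of - L(k p, k q) / k in k is k^-2 (L - k p L_p - k q L_q), where [lag_chargeE]
    recognizes the charge at the scaled velocities. *)
Lemma is_derive_scaled_lagrangian (k x : R) : 0 < k ->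
  is_derive k 1 (fun k => - k^-1 * scaled_along (lagrangian S) k x)
    (k ^- 2 * scaled_along (derrick_integrand S) k x).
Proof.
move=> k0; set p := derive1 u x; set q := derive1 alpha x.
have h0 := H_gt0 lambda_N_gt0 (u x) (alpha x).
have dp := is_derive_mul (is_derive_id k 1) (is_derive_const p k).
have dq := is_derive_mul (is_derive_id k 1) (is_derive_const q k).
have dL := is_derive_lag (lambda_p S) (h := fun=> H S (u x) (alpha x)) h0
  (is_derive_const _ _) (is_derive_const (u x) _) dp dq.
have dk := is_derive_opp (is_derive_inv (lt0r_neq0 k0) (is_derive_id k 1)).
apply: (is_derive_eq (is_derive_mul dk dL)).
rewrite /scaled_along -[derrick_integrand _ _ _ _ _]/(lag_charge (lambda_p S)
  (H S (u x) (alpha x)) (u x) (k * p) (k * q)) lag_chargeE//.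
by move: (lag _ _ _ _ _) (lag_h _ _ _ _ _) (lag_u _ _ _ _ _) (lag_p _ _ _ _ _)
  (lag_q _ _ _ _ _) => L Lh Lu Lp Lq; field; rewrite gt_eqF.
Qed.

Lemma is_derive_rescaled_energy :
  is_derive (1 : R) 1 (rescaled_energy S I u alpha)
    (\int[mu]_(x in I) along (derrick_integrand S) u alpha x).
Proof.
pose f (k x : R) : R := - k^-1 * scaled_along (lagrangian S) k x.
(* For k in ]1/2, 2[ the k-derivative is at most k^-2 (1 + k^2) <= 5 times |L|; the constant 20
   leaves room. *)
pose G (x : R) : R := 20 * `|along (lagrangian S) u alpha x|.
have I1 : `]2^-1, 2[%classic (1 : R) by rewrite /= in_itv/=; apply/andP; split; lra.
have pos k : `]2^-1, 2[%classic k -> 0 < k :> R.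
  by rewrite /= in_itv/= => /andP[+ _]; apply: lt_trans; rewrite invr_gt0.
have intf k : `]2^-1, 2[%classic k -> mu.-integrable I (EFin \o f k).
  move=> _; apply: (@eq_integrable _ _ _ mu I mI
    (fun x => ((- k^-1)%:E * (scaled_along (lagrangian S) k x)%:E)%E)) => //.
  by apply: integrableZl => //; exact: integrable_scaled_lagrangian.
have d1 k x : `]2^-1, 2[%classic k -> partial1of2 f k x
    = k ^- 2 * scaled_along (derrick_integrand S) k x.
  by move=> /pos /(is_derive_scaled_lagrangian x); exact: is_derive_derive1.
have derf k x : `]2^-1, 2[%classic k -> I x -> derivable (f ^~ x) k 1.
  by move=> /pos /(is_derive_scaled_lagrangian x)[].
have G0 x : 0 <= G x by rewrite mulr_ge0.
have fG k x : `]2^-1, 2[%classic k -> I x -> `|partial1of2 f k x| <= G x.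
  move=> Ik _; rewrite d1// normrM ger0_norm ?invr_ge0 ?sqr_ge0//.
  rewrite mulrC ler_pdivrMr ?exprn_gt0 ?pos//.
  apply: le_trans (norm_scaled_derrick k x) _.
  rewrite /G mulrAC ler_wpM2r//.
  by move: Ik; rewrite /= in_itv/= => /andP[k1 k2]; nra.
have dF := derivable_under_integral (mu := mu) (f := f) mI I1 intf derf G0 (int_majorant 20) fG.
have DF := differentiation_under_integral (mu := mu) (f := f) mI I1 intf derf G0 (int_majorant 20) fG.
(* The integral over the fixed [I] represents the energy for k > 0, hence near 1. *)
apply: (@near_eq_is_derive _ _ _ (fun k => \int[mu]_(x in I) f k x)).
  near=> k; rewrite rescaled_energyE//; near: k; exact: lt_nbhsr.
split => //; rewrite -derive1E DF.
by apply: eq_Rintegral => x _; rewrite d1// expr1n invr1 mul1r scaled_along1.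
Unshelve. all: by end_near. Qed.

End Rescaling.


(** Fermat's theorem: at a local maximum the right difference quotients are <= 0 and the left ones
    >= 0; a minimum is reduced to a maximum of -f. *)
Lemma is_derive_local_extremum (R : realType) (f : R -> R) (a df : R) :
  is_derive a 1 f df ->
  (\forall x \near a, f a <= f x) \/ (\forall x \near a, f x <= f a) -> df = 0.
Proof.
suff max (g : R -> R) (dg : R) :
    is_derive a 1 g dg -> (\forall x \near a, g x <= g a) -> dg = 0.
  move=> hf [fmin|]; last exact: max.
  have : - df = 0.
    apply: max (is_derive_opp hf) _.
    by apply: filterS fmin => x; rewrite lerN2.
  by move/eqP; rewrite oppr_eq0 => /eqP.
move=> [drg <-] /nbhs_ballP[e /= e0 gmax]; apply/eqP; rewrite eq_le; apply/andP; split.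
  rewrite ['D_1 g a]cvg_at_rightE//; apply: limr_le.
    by apply/cvg_ex; exists ('D_1 g a); exact: cvg_dnbhs_at_right drg.
  near=> h; apply: mulr_ge0_le0; first by rewrite invr_ge0.
  rewrite subr_le0 /= [_%:A]mulr1; apply: gmax.
  by rewrite /ball /= distrC addrK ger0_norm//; near: h; exact: nbhs_right_lt.
rewrite ['D_1 g a]cvg_at_leftE//; apply: limr_ge.
  by apply/cvg_ex; exists ('D_1 g a); exact: cvg_dnbhs_at_left drg.
near=> h; apply: mulr_le0; first by rewrite invr_le0.
rewrite subr_le0 /= [_%:A]mulr1; apply: gmax.
by rewrite /ball /= distrC addrK ltr0_norm// ltrNl; near: h; apply: nbhs_left_gt; rewrite oppr_lt0.
Unshelve. all: by end_near. Qed.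

(** * The supersymmetric profile *)

Section Supersymmetric.
Variables (R : realType) (S : setup R) (J : R).
Hypotheses (lambda_p_gt0 : 0 < lambda_p S) (lambda_N_gt0 : 0 < lambda_N S) (J_ge0 : 0 <= J).
Local Notation l := (lambda_p S).
Local Notation u := (susy_u S J).

(** With t = 2 x / l, cosh t, tanh t and tan alpha are all rational in this exponential, so the
    hyperbolic identities below become field identities. *)
Definition susy_exp (x : R) : R := expR (2 * x / l).
Local Notation E := susy_exp.

Lemma susy_exp_gt0 (x : R) : 0 < E x. Proof. exact: expR_gt0. Qed.

Lemma sqr_susy_u (x : R) : u x ^+ 2 = J * l * ((E x + (E x)^-1) / 2).
Proof.
have E0 := susy_exp_gt0 x.
rewrite /susy_u /cosh expRN -/(E _) exprMn !sqr_sqrtr; first by field; rewrite gt_eqF.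
  by rewrite mulr_ge0// divr_ge0// addr_ge0 ?invr_ge0// ltW.
by rewrite divr_ge0// mulr_ge0// ltW.
Qed.

Lemma is_derive_E (x : R) : is_derive x 1 E (E x * (2 / l)).
Proof.
have dlin := is_derive_mul (is_derive_mul (is_derive_const 2 x) (is_derive_id x 1))
  (is_derive_const l^-1 x).
have dE := is_derive1_comp (g := fun y : R => 2 * y / l) (is_derive_expR _) dlin.
by apply: (is_derive_eq dE); rewrite /susy_exp; ring.
Qed.

(** The constant sqrt (J l / 2) stays a factor of u on both sides, so nothing is divided by u and J
    = 0 is covered. *)
Lemma is_derive_susy_u (x : R) :
  is_derive x 1 u (u x * ((E x - (E x)^-1) / (E x + (E x)^-1)) / l).
Proof.
have E0 := susy_exp_gt0.
have uE : u = fun y => Num.sqrt (J * l / 2) * Num.sqrt (E y + (E y)^-1).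
  apply/funext => y; rewrite /susy_u /cosh expRN -/(E y); congr (_ * Num.sqrt _).
  by field; rewrite gt_eqF.
have C0 : 0 < E x + (E x)^-1 by rewrite addr_gt0 ?invr_gt0.
have dE := is_derive_E x.
have dC := is_derive_add dE (is_derive_inv (lt0r_neq0 (E0 x)) dE).
have dS := is_derive_sqrt (f := fun y => E y + (E y)^-1) C0 dC.
rewrite uE; apply: (is_derive_eq (is_derive_mul (is_derive_const (Num.sqrt (J * l / 2)) x) dS)).
rewrite mul0r add0r -!mulrA; congr (_ * _).
set s := Num.sqrt (E x + _); have s0 : 0 < s by rewrite sqrtr_gt0.
have sE : s ^+ 2 = E x + (E x)^-1 by rewrite sqr_sqrtr// ltW.
have -> : s * ((E x - (E x)^-1) * ((E x + (E x)^-1)^-1 * l^-1)) =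
  (E x - (E x)^-1) / (s * l).
  by rewrite -sE; field; rewrite !gt_eqF.
move: (E0 x) => E0x; field.
by rewrite !gt_eqF.
Qed.

(** The angle is known only through its tangent: differentiating tan alpha = E on the open set [I]
    gives (1 + E^2) alpha' = 2 E / l. *)
Lemma is_derive_susy_alpha (I : set R) (alpha : R -> R) (x : R) : open I -> I x ->
  derivable alpha x 1 -> (forall y, I y -> tan (alpha y) = E y) ->
  is_derive x 1 alpha (2 / (l * (E x + (E x)^-1))).
Proof.
move=> openI Ix da tanE; have E0 := susy_exp_gt0 x.
(* If the cosine vanished, [tan] would be 0 because the inverse of 0 is 0, against E > 0. *)
have cos0 : cos (alpha x) != 0.
  apply/negP => /eqP c0; have := tanE x Ix.
  by rewrite /tan c0 invr0 mulr0 => e; move: E0; rewrite -e ltxx.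
have hda := derivable_is_derive1 da.
have dtan := is_derive1_comp (is_derive_tan cos0) hda.
have dtanE : is_derive x 1 (tan \o alpha) (E x * (2 / l)).
  apply: near_eq_is_derive (is_derive_E x).
  by apply: filterS (open_nbhs_nbhs (conj openI Ix)) => y Iy /=; rewrite tanE.
have := is_derive_derive1 dtan; rewrite (is_derive_derive1 dtanE) cos2_tan2// tanE// => e.
apply: (is_derive_eq hda).
have E20 : 1 + E x ^+ 2 != 0 by rewrite gt_eqF// addr_gt0// exprn_gt0.
have -> : derive1 alpha x = (1 + E x ^+ 2) * derive1 alpha x / (1 + E x ^+ 2).
  by rewrite mulrAC mulfV// mul1r.
rewrite -e; move: (E x) E0 E20 => c c0 c20; field.
by rewrite -expr2 addrC c20 !gt_eqF.
Qed.

Variables (I : set R) (alpha : R -> R).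
Hypotheses (openI : open I) (dalpha : forall x, I x -> derivable alpha x 1)
  (tanE : forall x, I x -> tan (alpha x) = E x).

(** This is 1 / cosh^2 + tanh^2 = 1, multiplied by u^2 / l^2. *)
Lemma susy_velocity (x : R) : I x ->
  (u x * derive1 alpha x) ^+ 2 + derive1 u x ^+ 2 = u x ^+ 2 / l ^+ 2.
Proof.
move=> Ix; have E0 := susy_exp_gt0 x.
rewrite (is_derive_derive1 (is_derive_susy_u x)).
rewrite (is_derive_derive1 (is_derive_susy_alpha openI Ix (dalpha Ix) tanE)).
move: (u x) (E x) E0 => v c c0; field.
by rewrite (gt_eqF c0) (gt_eqF lambda_p_gt0) gt_eqF// addr_gt0// mulr_gt0.
Qed.

Lemma susy_kin_vel (x : R) : I x ->
  vel (H S (u x) (alpha x)) (u x) (derive1 u x) (derive1 alpha x)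
  = kin l (H S (u x) (alpha x)) (u x).
Proof. by move=> Ix; rewrite /vel susy_velocity. Qed.

Lemma susy_kin_neq0 (x : R) : kin l (H S (u x) (alpha x)) (u x) != 0.
Proof.
by rewrite gt_eqF// (lt_le_trans ltr01)// kin_ge1// ltW// H_gt0.
Qed.

(** The two square roots cancel and leave u^2 alpha', with u^2 = J l cosh t and alpha' = 1 / (l cosh
    t). *)
Lemma susy_J_charge (x : R) : I x -> along (J_charge S) u alpha x = J.
Proof.
move=> Ix; have E0 := susy_exp_gt0 x.
rewrite /along -[J_charge _ _ _ _ _]/(u x ^+ 2 * derive1 alpha x *
  kin l (H S (u x) (alpha x)) (u x) /
  vel (H S (u x) (alpha x)) (u x) (derive1 u x) (derive1 alpha x)).
rewrite susy_kin_vel// mulfK ?susy_kin_neq0// sqr_susy_u.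
rewrite (is_derive_derive1 (is_derive_susy_alpha openI Ix (dalpha Ix) tanE)).
move: (E x) E0 => c c0; field.
by rewrite (gt_eqF c0) (gt_eqF lambda_p_gt0) gt_eqF// addr_gt0// mulr_gt0.
Qed.

Lemma susy_derrick_integrand (x : R) : I x ->
  along (derrick_integrand S) u alpha x = 0.
Proof.
move=> Ix; rewrite /along -[derrick_integrand _ _ _ _ _]/(lag_charge l
  (H S (u x) (alpha x)) (u x) (derive1 u x) (derive1 alpha x)).
by rewrite /lag_charge susy_kin_vel// divff ?susy_kin_neq0// subrr mulr0.
Qed.

(** Equality of the two square roots gives L = - H^-1 (A^2 - 1), from which [H] cancels; on [I], L
    thus agrees with a function continuous on the whole line. *)
Lemma susy_lagrangian (x : R) : I x ->
  along (lagrangian S) u alpha x = - (u x ^+ 2 / l ^+ 2).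
Proof.
move=> Ix; rewrite /along -[lagrangian _ _ _ _ _]/(lag l
  (H S (u x) (alpha x)) (u x) (derive1 u x) (derive1 alpha x)).
have h0 := H_gt0 lambda_N_gt0 (u x) (alpha x).
rewrite /lag susy_kin_vel// -mulrA -expr2 /kin sqr_sqrtr; last first.
  by rewrite (le_trans ler01)// kin_arg_ge1// ltW.
by field; rewrite !gt_eqF.
Qed.

Lemma susy_C1_u : C1 I u.
Proof.
move=> x _; split; first by have [] := is_derive_susy_u x.
have -> : derive1 u = fun y => u y * ((E y - (E y)^-1) / (E y + (E y)^-1)) / l.
  by apply/funext => y; exact: is_derive_derive1 (is_derive_susy_u y).
have E0 := susy_exp_gt0 x.
have C0 : E x + (E x)^-1 != 0 by rewrite gt_eqF// addr_gt0 ?invr_gt0.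
have dE := is_derive_E x; have dV := is_derive_inv (lt0r_neq0 E0) dE.
have dC := is_derive_inv (f := fun y => E y + (E y)^-1) C0 (is_derive_add dE dV).
have [d _] := is_derive_mul (is_derive_mul (is_derive_susy_u x)
  (is_derive_mul (is_derive_add dE (is_derive_opp dV)) dC)) (is_derive_const l^-1 x).
exact: derivable_continuous d.
Qed.

Lemma susy_C1_alpha : C1 I alpha.
Proof.
move=> x Ix; split; first exact: dalpha.
have E0 := susy_exp_gt0 x.
have C0 : l * (E x + (E x)^-1) != 0.
  by rewrite mulf_neq0// gt_eqF// addr_gt0 ?invr_gt0.
have dE := is_derive_E x; have dV := is_derive_inv (lt0r_neq0 E0) dE.
have dC := is_derive_inv (f := fun y => l * (E y + (E y)^-1)) C0
  (is_derive_mul (is_derive_const l x) (is_derive_add dE dV)).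
have [d _] := is_derive_mul (is_derive_const 2 x) dC.
(* The closed form of alpha' is known on [I] only; openness makes it hold near x, which suffices for
   continuity there. *)
have near_da : \forall y \near x, 2 * (l * (E y + (E y)^-1))^-1 = derive1 alpha y.
  apply: filterS (open_nbhs_nbhs (conj openI Ix)) => y Iy.
  by rewrite (is_derive_derive1 (is_derive_susy_alpha openI Iy (dalpha Iy) tanE)).
rewrite /prop_for /continuous_at -(nbhs_singleton near_da).
apply: cvg_trans (derivable_continuous d).
exact: near_eq_cvg.
Qed.

Lemma susy_integrable_lagrangian : bounded_set I ->
  integrable_along (lagrangian S) I u alpha.
Proof.
move=> [M [_ bM]]; have mI : measurable I by exact: open_measurable.
have cv : continuous (fun x => - (u x ^+ 2 / l ^+ 2)).
  move=> x; have [d _] := is_derive_opp (is_derive_mul (is_derive_sqr (is_derive_susy_u x))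
    (is_derive_const (l ^+ 2)^-1 x)).
  exact: derivable_continuous d.
(* [bounded_set] bounds [I] by every radius strictly above [M], hence the shift by 1. *)
pose K : set R := `[- (M + 1), M + 1]%classic.
have IK : I `<=` K.
  by move=> x Ix; rewrite /K /= in_itv/= -ler_norml; apply: bM Ix; rewrite ltrDl.
have intK := continuous_compact_integrable (segment_compact (a := - (M + 1)) (b := M + 1))
  (continuous_subspaceT cv).
have intI := @integrableS _ _ _ (@lebesgue_measure R) K I _ (measurable_itv _) mI IK intK.
apply: (@eq_integrable _ _ _ (@lebesgue_measure R) I mI _ _ _ intI).
by move=> x /set_mem Ix; rewrite /= susy_lagrangian.
Qed.

End Supersymmetric.

Unset Implicit Arguments.

Theorem mainTheorem5 (R : realType) (S : setup R)
    (lambda_p_gt0 : 0 < lambda_p S) (lambda_N_gt0 : 0 < lambda_N S)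
    (l_s_gt0 : 0 < l_s S) :
  (* the Derrick-type condition *)
  (forall (I : set R) (u alpha : R -> R),
    open I -> is_interval I ->
    C1 I u -> C1 I alpha -> avoids_branes S I u alpha ->
    integrable_along (lagrangian S) I u alpha ->
    [/\ (forall lambda : R, 0 < lambda ->
           integrable_along (lagrangian S) (rescale_dom I lambda)
             (rescale u lambda) (rescale alpha lambda)),
        integrable_along (derrick_integrand S) I u alpha,
        is_derive (1 : R) 1 (rescaled_energy S I u alpha)
          (\int[lebesgue_measure]_(x in I)
             along (derrick_integrand S) u alpha x) &
        ((\forall lambda \near (1 : R),
            rescaled_energy S I u alpha 1
              <= rescaled_energy S I u alpha lambda) \/
         (\forall lambda \near (1 : R),
            rescaled_energy S I u alpha lambda
              <= rescaled_energy S I u alpha 1) ->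
         \int[lebesgue_measure]_(x in I)
            along (derrick_integrand S) u alpha x = 0)]) /\
  (* the integrand is P_6, and it is the energy of the 0+1 system *)
  (forall u alpha du da : R,
    derrick_integrand S u alpha du da
      = shift_charge (lagrangian S) u alpha du da /\
    derrick_integrand S u alpha du da
      = mechanical_energy
          (fun u alpha du da => - lagrangian S u alpha du da) u alpha du da) /\
  (* P_6 is the Noether charge of shifts: invariance and conservation *)
  (forall (I : set R) (u alpha : R -> R) (c : R),
    open I -> is_interval I ->
    C1 I u -> C1 I alpha -> avoids_branes S I u alpha ->
    integrable_along (lagrangian S) I u alpha ->
    integrable_along (lagrangian S) (shift_dom I c)
      (shift_profile u c) (shift_profile alpha c) /\
    action (lagrangian S) (shift_dom I c)
      (shift_profile u c) (shift_profile alpha c)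
      = action (lagrangian S) I u alpha) /\
  (forall (I : set R) (u alpha : R -> R),
    open I -> is_interval I ->
    twice_derivable I u -> twice_derivable I alpha ->
    avoids_branes S I u alpha ->
    euler_lagrange (lagrangian S) I u alpha ->
    forall x y : R, I x -> I y ->
      along (shift_charge (lagrangian S)) u alpha x
        = along (shift_charge (lagrangian S)) u alpha y) /\
  (* the supersymmetric profile *)
  (forall (J : R) (I : set R) (alpha : R -> R),
    0 <= J -> open I -> is_interval I ->
    (forall x, I x -> derivable alpha x 1) ->
    (forall x, I x -> tan (alpha x) = expR (2 * x / lambda_p S)) ->
    avoids_branes S I (susy_u S J) alpha ->
    [/\ (forall x, I x -> along (J_charge S) (susy_u S J) alpha x = J),
        (forall x, I x ->
           along (shift_charge (lagrangian S)) (susy_u S J) alpha x = 0),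
        \int[lebesgue_measure]_(x in I)
           along (derrick_integrand S) (susy_u S J) alpha x = 0 &
        (bounded_set I ->
         integrable_along (lagrangian S) I (susy_u S J) alpha /\
         is_derive (1 : R) 1 (rescaled_energy S I (susy_u S J) alpha) 0)]).
Proof.
split; [|split; [|split; [|split]]].
- move=> I u alpha oI _ Cu Ca nb intL.
  have dE := is_derive_rescaled_energy lambda_N_gt0 oI Cu Ca nb intL.
  split.
  + by move=> k k0; exact: integrable_rescale.
  + exact: integrable_derrick.
  + exact: dE.
  + by move=> extr; exact: is_derive_local_extremum dE extr.
- move=> u alpha du da; rewrite mechanical_energy_opp//.
  by rewrite derrick_integrand_shift_charge.
- by move=> I u alpha c oI _ Cu Ca nb intL; exact: shift_invariance.
- move=> I u alpha _ itvI du da nb el; apply: (is_derive0_cst_interval itvI) => x Ix.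
  exact: is_derive_shift_charge el.
- move=> J I alpha J0 oI _ da tanE nb.
  have derrick0 x : I x -> along (derrick_integrand S) (susy_u S J) alpha x = 0.
    by move=> Ix; exact: susy_derrick_integrand tanE x Ix.
  have intD0 : \int[lebesgue_measure]_(x in I)
      along (derrick_integrand S) (susy_u S J) alpha x = 0.
    transitivity (\int[@lebesgue_measure R]_(x in I) (0 : R)).
      by apply: eq_Rintegral => x /set_mem Ix; rewrite derrick0.
    by rewrite Rintegral_cst ?mul0r//; exact: open_measurable.
  split=> //.
  + by move=> x Ix; exact: susy_J_charge tanE x Ix.
  + by move=> x Ix; rewrite -[RHS](derrick0 x Ix) /along derrick_integrand_shift_charge.
  (* On bounded [I] the Lagrangian is integrable, so the general derivative formula applies, and its
     value is the integral just shown to vanish. *)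
  + move=> bI; have intL : integrable_along (lagrangian S) I (susy_u S J) alpha.
      exact: susy_integrable_lagrangian tanE bI.
    split=> //; rewrite -intD0; apply: is_derive_rescaled_energy => //.
    * exact: susy_C1_u.
    * exact: susy_C1_alpha tanE.
Qed.
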